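(* Let $G$ be either an associative algebra or a Lie algebra over a field, and let $N$ be an ideal of $G$ such that the factor algebra $G/N$ is finite-dimensional. Suppose that $N$ possesses a series $$\{0\}=A_0\subseteq A_1\subseteq\cdots\subseteq A_n=N,\qquad A_i\triangleleft G,$$ such that each quotient $A_i/A_{i-1}$ either satisfies a multilinear identity $w_i=0$, or is locally nilpotent. Then $G$ contains an ideal $M$ such that $G/M$ is finite-dimensional, $M$ is invariant under all automorphisms of $G$, and $M$ has the same property, that is, $M$ possesses a series of the same length $$\{0\}=B_0\subseteq B_1\subseteq\cdots\subseteq B_n=M,\qquad B_i\triangleleft G,$$ in which each quotient $B_i/B_{i-1}$ satisfies the same identity $w_i=0$, or is locally nilpotent, according to the corresponding quotient $A_i/A_{i-1}$ of the original series.
   Context: Ideals are two-sided; $I\triangleleft A$ means that $I$ is an ideal of $A$. An algebra is locally nilpotent if each of its finitely generated subalgebras is nilpotent. A multilinear identity is an identity $w=0$ where $w(x_1,\ldots,x_n)$ is a multilinear element of a free algebra, i.e. a linear combination of monomials each containing each of $x_1,\ldots,x_n$ exactly once. *)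

(* Defs.v *)
From HB Require Import structures.
From mathcomp Require Import all_boot all_order all_algebra.
From mathcomp Require Import boolp classical_sets.

Set Implicit Arguments.
Unset Strict Implicit.
Unset Printing Implicit Defensive.

Import GRing.Theory.
Local Open Scope ring_scope.
Local Open Scope classical_set_scope.
Local Open Scope quotient_scope.

(* Algebras over a field: no unit and no finiteness is assumed, and the       *)
(* bilinear product is arbitrary, so that associative and Lie algebras are    *)
(* instances of the same structure.                                           *)
HB.mixin Record Lmodule_isNAAlgebra (F : fieldType) V of GRing.Lmodule F V := {
  amul : V -> V -> V;
  amul_linearl : forall y : V, linear (amul^~ y);
  amul_linearr : forall x : V, linear (amul x)
}.

#[short(type="naAlgType")]
HB.structure Definition NAAlgebra (F : fieldType) :=
  {V of Lmodule_isNAAlgebra F V & GRing.Lmodule F V}.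

Section Algebras.
Variables (F : fieldType) (G : naAlgType F).
Implicit Types (x y z : G) (S : set G).

Definition is_associative : Prop :=
  forall x y z, amul x (amul y z) = amul (amul x y) z.

Definition is_lie : Prop :=
  (forall x, amul x x = 0) /\
  (forall x y z,
     amul x (amul y z) + amul y (amul z x) + amul z (amul x y) = 0).

Definition is_subspace S : Prop :=
  S 0 /\ forall (a : F) x y, S x -> S y -> S (a *: x + y).

Definition is_subalgebra S : Prop :=
  is_subspace S /\ forall x y, S x -> S y -> S (amul x y).

Definition is_automorphism (phi : G -> G) : Prop :=
  [/\ linear phi, bijective phi & {morph phi : x y / amul x y}].

Record ideal : Type := Ideal {
  ideal_set :> set G;
  ideal_subspace : is_subspace ideal_set;
  ideal_mul : forall x y, ideal_set x ->
    ideal_set (amul x y) /\ ideal_set (amul y x)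
}.

(* Left-normed products of m + 1 factors all vanish.  In an associative or in *)
(* a Lie algebra these products span the (m+1)-st power, respectively the     *)
(* (m+1)-st term of the lower central series.                                 *)
Definition nilpotent_subalg S : Prop :=
  exists m : nat, forall x (s : seq G),
    S x -> [set` s] `<=` S -> size s = m -> foldl amul x s = 0.

Definition locally_nilpotent S : Prop :=
  forall s : seq G, [set` s] `<=` S ->
    nilpotent_subalg (smallest is_subalgebra [set` s]).

End Algebras.

(* Monomials of the free (non-associative) algebra; identities of associative *)
(* and of Lie algebras are represented by preimages in this free algebra.     *)
Inductive monomial (X : Type) : Type :=
  | Var of X
  | Mul of monomial X & monomial X.

Fixpoint vars X (t : monomial X) : seq X :=
  match t with
  | Var x => [:: x]
  | Mul t1 t2 => vars t1 ++ vars t2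
  end.

Fixpoint meval (F : fieldType) (G : naAlgType F) X (v : X -> G)
    (t : monomial X) : G :=
  match t with
  | Var x => v x
  | Mul t1 t2 => amul (meval v t1) (meval v t2)
  end.

(* A linear combination of monomials, given by its list of coefficients and   *)
(* monomials.                                                                 *)
Record mlpoly (F : fieldType) : Type := MLPoly {
  ml_arity : nat;
  ml_terms : seq (F * monomial 'I_ml_arity);
  ml_multilinear :
    all (fun p => perm_eq (vars p.2) (enum 'I_ml_arity)) ml_terms
}.

Definition satisfies_identity (F : fieldType) (G : naAlgType F) (S : set G)
    (w : mlpoly F) : Prop :=
  forall v : 'I_(ml_arity w) -> G, (forall i, S (v i)) ->
    \sum_(p <- ml_terms w) p.1 *: meval v p.2 = 0.

Section QuotientAlgebra.
Variables (F : fieldType) (G : naAlgType F) (I : ideal G).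

Definition ideal_pred : {pred G} := fun x => `[< ideal_set I x >].

Lemma ideal_predP x : reflect (ideal_set I x) (x \in ideal_pred).
Proof. exact: asboolP. Qed.

Lemma ideal_pred_zmod : zmod_closed ideal_pred.
Proof.
have [I0 Ilin] := ideal_subspace I.
split=> [|x y /ideal_predP Ix /ideal_predP Iy]; first exact/ideal_predP.
by apply/ideal_predP; rewrite addrC -scaleN1r; apply: Ilin.
Qed.

HB.instance Definition _ := GRing.isZmodClosed.Build G ideal_pred ideal_pred_zmod.

Definition quot_alg : Type := Quotient.quot ideal_pred.

HB.instance Definition _ := GRing.Zmodule.on quot_alg.
HB.instance Definition _ := EqQuotient.on quot_alg.

Definition quot_pi (x : G) : quot_alg := \pi_quot_alg x.

Lemma quot_piP x y : quot_pi x = quot_pi y <-> ideal_set I (x - y).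
Proof.
split=> [/eqP|Ixy].
  rewrite -[_ == _]/(x == y %[mod Quotient.quot ideal_pred]).
  by rewrite -Quotient.idealrBE => /ideal_predP.
apply/eqP; rewrite -[_ == _]/(x == y %[mod Quotient.quot ideal_pred]).
by rewrite -Quotient.idealrBE; apply/ideal_predP.
Qed.

Lemma quot_piD x y : quot_pi (x + y) = quot_pi x + quot_pi y.
Proof. exact: (raddfD (\pi_(Quotient.quot ideal_pred))). Qed.

Lemma quot_reprK (q : quot_alg) : quot_pi (repr q) = q.
Proof. exact: reprK. Qed.

Definition quot_scale (a : F) (q : quot_alg) : quot_alg :=
  quot_pi (a *: repr q).

Definition quot_mul (q r : quot_alg) : quot_alg :=
  quot_pi (amul (repr q) (repr r)).

Lemma ideal_scale a x : ideal_set I x -> ideal_set I (a *: x).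
Proof.
have [I0 Ilin] := ideal_subspace I.
by move=> Ix; rewrite -[_ *: _]addr0; apply: Ilin.
Qed.

Lemma quot_piZ a x : quot_pi (a *: x) = quot_scale a (quot_pi x).
Proof.
apply/quot_piP; rewrite -scalerBr; apply: ideal_scale.
by apply/quot_piP; rewrite quot_reprK.
Qed.

Lemma amulBl (x y z : G) : amul (x - y) z = amul x z - amul y z.
Proof.
have := amul_linearl z (-1) y x.
by rewrite /= !scaleN1r ![- _ + _]addrC.
Qed.

Lemma amulBr (x y z : G) : amul z (x - y) = amul z x - amul z y.
Proof.
have := amul_linearr z (-1) y x.
by rewrite /= !scaleN1r ![- _ + _]addrC.
Qed.

Lemma quot_piM x y : quot_pi (amul x y) = quot_mul (quot_pi x) (quot_pi y).
Proof.
have Ir z : ideal_set I (z - repr (quot_pi z)) by apply/quot_piP; rewrite quot_reprK.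
rewrite /quot_mul; transitivity (quot_pi (amul (repr (quot_pi x)) y)).
  by apply/quot_piP; rewrite -amulBl; case: (ideal_mul y (Ir x)).
by apply/quot_piP; rewrite -amulBr; case: (ideal_mul (repr (quot_pi x)) (Ir y)).
Qed.

Lemma quot_scaleA a b q :
  quot_scale a (quot_scale b q) = quot_scale (a * b) q.
Proof. by rewrite -[q]quot_reprK -!quot_piZ scalerA. Qed.

Lemma quot_scale1 : left_id 1 quot_scale.
Proof. by move=> q; rewrite -[q]quot_reprK -!quot_piZ scale1r. Qed.

Lemma quot_scaleDr : right_distributive quot_scale +%R.
Proof.
move=> a q r; rewrite -[q]quot_reprK -[r]quot_reprK.
by rewrite -quot_piD -!quot_piZ -quot_piD scalerDr.
Qed.

Lemma quot_scaleDl q : {morph quot_scale^~ q : a b / a + b}.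
Proof.
by move=> a b /=; rewrite -[q]quot_reprK -!quot_piZ -quot_piD scalerDl.
Qed.

HB.instance Definition _ := GRing.Zmodule_isLmodule.Build F quot_alg
  quot_scaleA quot_scale1 quot_scaleDr quot_scaleDl.

Lemma quot_pi_linear : linear quot_pi.
Proof. by move=> a x y; rewrite quot_piD quot_piZ. Qed.

Lemma quot_mul_linearl r : linear (quot_mul^~ r).
Proof.
move=> a p q /=; rewrite -[p]quot_reprK -[q]quot_reprK -[r]quot_reprK.
by rewrite -quot_pi_linear -!quot_piM -quot_pi_linear amul_linearl.
Qed.

Lemma quot_mul_linearr r : linear (quot_mul r).
Proof.
move=> a p q /=; rewrite -[p]quot_reprK -[q]quot_reprK -[r]quot_reprK.
by rewrite -quot_pi_linear -!quot_piM -quot_pi_linear amul_linearr.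
Qed.

HB.instance Definition _ := Lmodule_isNAAlgebra.Build F quot_alg
  quot_mul_linearl quot_mul_linearr.

End QuotientAlgebra.

Definition finite_dimensional (F : fieldType) (V : lmodType F) : Prop :=
  exists n : nat, inhabited (Vector.axiom n V).

(* The condition imposed on a factor of a series: a given multilinear         *)
(* identity, or local nilpotency.                                             *)
Inductive factor_type (F : fieldType) : Type :=
  | Identity of mlpoly F
  | LocallyNilpotent.
Arguments LocallyNilpotent {F}.

Definition has_factor_type (F : fieldType) (G : naAlgType F) (S : set G)
    (c : factor_type F) : Prop :=
  match c with
  | Identity w => satisfies_identity S w
  | LocallyNilpotent => locally_nilpotent S
  end.

(* The factor J / I is the image of J in the quotient algebra G / I.  Factors *)
(* are numbered from 0: c i is the type of A_(i+1) / A_i.                     *)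
Definition has_series (F : fieldType) (G : naAlgType F) (n : nat)
    (c : nat -> factor_type F) (N : ideal G) : Prop :=
  exists A : nat -> ideal G,
    [/\ A 0%N = [set 0] :> set G,
        A n = N :> set G,
        forall i : nat, (i < n)%N -> A i `<=` A i.+1 &
        forall i : nat, (i < n)%N ->
          has_factor_type (quot_pi (A i) @` A i.+1) (c i)].

(* Main.v *)
Require Import Defs.
From mathcomp Require Import all_boot all_order all_algebra.
From mathcomp Require Import boolp classical_sets cardinality.
Local Open Scope ring_scope.
Local Open Scope classical_set_scope.
Set Implicit Arguments.
Unset Strict Implicit.
Unset Printing Implicit Defensive.
Import GRing.Theory.

(** The proof has two independent halves.

    Symmetrization.  Suppose that a predicate P on finite tuples of ideals is
    antitone, invariant under automorphisms, and additive in each coordinate: if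
    P holds of two tuples that differ only at t0, it holds when their entries at
    t0 are added ([multiadditive]).  If P (N, ..., N) holds and N has finite
    codimension, then P (H, ..., H) holds for an invariant H of finite
    codimension ([symmetrization]).  Indeed, suppose that P holds of every
    tuple having N in at least k places and an invariant H containing N in the
    others.  Let H' be the sum of all images of N under automorphisms.  It is
    invariant, and since N has finite codimension it is already the sum of N and
    finitely many images; let N' be the intersection of these.  Given a tuple
    with N' in k - 1 places and H' in the others, one entry H' is expanded as a
    sum.  With that entry replaced by an image phi(N), the tuple lies below the
    image under phi of a tuple with N in k places and H in the others, so P
    holds.  Hence N' and H' work for k - 1; k is brought down from the length
    of the tuple to 0.

    Series as diagonals.  Having a series of given factor types is of the form
    P (X, ..., X) with P as above ([series_multiadditive]), by induction on the
    length: P holds of a family X_(t, u) if P' holds of some Z_t, where P'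
    belongs to the shorter series, such that each row X_(t, -) is related to
    Z_t by the law of the top factor.  Intersecting the finitely many Z_t
    recovers a series on the diagonal.  The law of a multilinear identity w is
    w(X_1, ..., X_m) <= Z; that of local nilpotency is that X is locally
    nilpotent modulo Z.  The coordinates of w must be allowed to vary
    independently for additivity to hold.  For local nilpotency, additivity
    says that the sum of two locally nilpotent ideals is locally nilpotent, the
    Hirsch-Plotkin theorem ([nil_mod_add]).  It is proved for the associative
    and the Lie case at once, from the identity
    (x y) z = x (y z) + e (x z) y with e = 0 or 1. *)

(** * Subspaces and ideals *)

Section Linear.
Variables (F : fieldType) (U V : lmodType F) (f : U -> V).
Hypothesis f_lin : linear f.

Lemma lin0 : f 0 = 0.
Proof. by have := f_lin (-1) 0 0; rewrite !scaleN1r !addNr. Qed.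

Lemma linD x y : f (x + y) = f x + f y.
Proof. by have := f_lin 1 x y; rewrite !scale1r. Qed.

Lemma linZ a x : f (a *: x) = a *: f x.
Proof. by have := f_lin a x 0; rewrite lin0 !addr0. Qed.

Lemma linB x y : f (x - y) = f x - f y.
Proof. by rewrite linD -scaleN1r linZ scaleN1r. Qed.

End Linear.

Section Subspaces.
Variables (F : fieldType) (G : naAlgType F).
Implicit Types (x y z u v : G) (S A B : set G).

Lemma subspaceD S x y : is_subspace S -> S x -> S y -> S (x + y).
Proof. by move=> [_ Slin] Sx Sy; rewrite -[x]scale1r; apply: Slin. Qed.

Lemma subspaceZ S a x : is_subspace S -> S x -> S (a *: x).
Proof. by move=> [S0 Slin] Sx; rewrite -[_ *: x]addr0; apply: Slin. Qed.

Lemma subspaceB S x y : is_subspace S -> S x -> S y -> S (x - y).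
Proof.
by move=> Ssub Sx Sy; apply: subspaceD => //; rewrite -scaleN1r; apply: subspaceZ.
Qed.

Lemma subspace_sum S (I : Type) (r : seq I) (h : I -> G) :
  is_subspace S -> (forall i, S (h i)) -> S (\sum_(i <- r) h i).
Proof.
move=> Ssub Sh; elim/big_ind: _ => // [|x y]; first by case: Ssub.
exact: subspaceD.
Qed.

Lemma subspace_set0 : is_subspace [set 0 : G].
Proof. by split=> // a x y -> ->; rewrite scaler0 addr0. Qed.

Lemma subspace_preimage (H : naAlgType F) (f : G -> H) (S : set H) :
  linear f -> is_subspace S -> is_subspace (f @^-1` S).
Proof.
move=> f_lin [S0 Slin]; split; first by rewrite /preimage /= lin0.
by move=> a x y Sx Sy; rewrite /preimage /= f_lin; apply: Slin.
Qed.

Definition span S : set G := smallest (@is_subspace F G) S.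

Lemma span_subspace S : is_subspace (span S).
Proof.
split=> [V [[]] //|a x y Sx Sy V VS].
by have [[_ Vlin] _] := VS; apply: Vlin; [apply: Sx|apply: Sy].
Qed.

Lemma sub_span S : S `<=` span S.
Proof. exact: sub_smallest. Qed.

Lemma span_min S V : is_subspace V -> S `<=` V -> span S `<=` V.
Proof. exact: smallest_sub. Qed.

Lemma span_mono A B : A `<=` B -> span A `<=` span B.
Proof.
move=> AB; apply: span_min; first exact: span_subspace.
by apply: subset_trans AB _; apply: sub_span.
Qed.

Lemma span_mulr S V y : is_subspace V -> (forall u, S u -> V (amul u y)) ->
  forall u, span S u -> V (amul u y).
Proof.
move=> Vsub SV; apply: span_min => //.
by apply: subspace_preimage => //; apply: amul_linearl.
Qed.

Lemma span_mull S V x : is_subspace V -> (forall u, S u -> V (amul x u)) ->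
  forall u, span S u -> V (amul x u).
Proof.
move=> Vsub SV; apply: span_min => //.
by apply: subspace_preimage => //; apply: amul_linearr.
Qed.

Lemma ideal_mull (I : ideal G) x y : ideal_set I x -> ideal_set I (amul x y).
Proof. by move=> /(ideal_mul y)[]. Qed.

Lemma ideal_mulr (I : ideal G) x y : ideal_set I x -> ideal_set I (amul y x).
Proof. by move=> /(ideal_mul y)[]. Qed.

Definition add_set (A B : set G) : set G := [set x + y | x in A & y in B].

Lemma add_set_subspace A B :
  is_subspace A -> is_subspace B -> is_subspace (add_set A B).
Proof.
move=> [A0 Alin] [B0 Blin]; split; first by exists 0 => //; exists 0; rewrite ?addr0.
move=> a _ _ [x Ax [y By <-]] [x' Ax' [y' By' <-]].
exists (a *: x + x'); first exact: Alin.
by exists (a *: y + y'); [exact: Blin|rewrite scalerDr addrACA].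
Qed.

Lemma add_set_mul (I J : ideal G) x y : add_set I J x ->
  add_set I J (amul x y) /\ add_set I J (amul y x).
Proof.
move=> [u Iu [v Jv <-]]; split.
  rewrite (linD (amul_linearl y)).
  by exists (amul u y); [exact: ideal_mull|exists (amul v y) => //; exact: ideal_mull].
rewrite (linD (amul_linearr y)).
by exists (amul y u); [exact: ideal_mulr|exists (amul y v) => //; exact: ideal_mulr].
Qed.

Definition ideal_add (I J : ideal G) : ideal G :=
  Ideal (add_set_subspace (ideal_subspace I) (ideal_subspace J)) (@add_set_mul I J).

Lemma ideal_add_subl (I J : ideal G) : I `<=` ideal_add I J.
Proof.
by move=> x Ix; exists x => //; exists 0; rewrite ?addr0 //; case: (ideal_subspace J).
Qed.

Lemma ideal_add_subr (I J : ideal G) : J `<=` ideal_add I J.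
Proof.
by move=> x Jx; exists 0; [case: (ideal_subspace I)|exists x; rewrite ?add0r].
Qed.

Lemma ideal_add_min (I J K : ideal G) :
  I `<=` K -> J `<=` K -> ideal_add I J `<=` K.
Proof.
move=> IK JK _ [x /IK Kx [y /JK Ky <-]].
by apply: subspaceD (ideal_subspace K) _ _.
Qed.

Lemma setI_subspace A B :
  is_subspace A -> is_subspace B -> is_subspace (A `&` B).
Proof.
move=> [A0 Alin] [B0 Blin]; split=> // a x y [Ax Bx] [Ay By].
by split; [exact: Alin|exact: Blin].
Qed.

Lemma setI_mul (I J : ideal G) x y : (I `&` J) x ->
  (I `&` J) (amul x y) /\ (I `&` J) (amul y x).
Proof.
by move=> [Ix Jx]; split; split; do ?exact: ideal_mull; exact: ideal_mulr.
Qed.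

Definition ideal_cap (I J : ideal G) : ideal G :=
  Ideal (setI_subspace (ideal_subspace I) (ideal_subspace J)) (@setI_mul I J).

Lemma setT_subspace : is_subspace [set: G].
Proof. by []. Qed.

Definition ideal_full : ideal G :=
  Ideal setT_subspace (fun _ _ _ => conj Logic.I Logic.I).

(** * Left-normed products *)

(** Left-normed products u y_1 ... y_k with u in A and all y_i in B. *)
Fixpoint words A B (k : nat) : set G :=
  if k is k'.+1 then [set amul u y | u in words A B k' & y in B] else A.

Lemma words_mono A A' B B' k :
  A `<=` A' -> B `<=` B' -> words A B k `<=` words A' B' k.
Proof.
move=> AA' BB'; elim: k => [|k IH] //= _ [u Au] [y By] <-.
by exists u; [apply: IH|exists y => //; apply: BB'].
Qed.

(** The first tail factor can be absorbed in the head, which places products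
    with head in one ideal and tail in another in the second ideal. *)
Lemma words_shift A B k :
  words A B k.+1 = words [set amul u y | u in A & y in B] B k.
Proof. by elim: k => [|k IH] //=; rewrite -IH. Qed.

Lemma finite_words A B k :
  finite_set A -> finite_set B -> finite_set (words A B k).
Proof. by move=> finA finB; elim: k => //= k IH; apply: finite_image2. Qed.

Lemma words_sub_ideal (I : ideal G) A B k : A `<=` I -> words A B k `<=` I.
Proof.
move=> AI; elim: k => //= k IH _ [u /IH Iu] [y _] <-.
by case: (ideal_mul y Iu).
Qed.

Lemma words_ideal_leq (Z : ideal G) A B m k : (m <= k)%N ->
  words A B m `<=` Z -> words A B k `<=` Z.
Proof.
move=> /subnK <- mZ; elim: (k - m)%N => //= i IH _ [u /IH Zu] [y _] <-.
by case: (ideal_mul y Zu).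
Qed.

Lemma words_span S Y k : S `<=` span Y -> words S S k `<=` span (words Y Y k).
Proof.
move=> SY; elim: k => //= k IH _ [u /IH Yu] [y /SY Yy] <-.
have spansub := span_subspace (words Y Y k.+1).
apply: (span_mulr spansub _ Yu) => {Yu}u Yu.
apply: (span_mull spansub _ Yy) => {Yy}y Yy.
by apply: sub_span => /=; exists u => //; exists y.
Qed.

Lemma words_foldl S k z :
  words S S k z <->
  exists x t, [/\ S x, [set` t] `<=` S, size t = k & z = foldl amul x t].
Proof.
split=> [|[x [t [Sx tS <- ->]]]].
  elim: k z => [z Sz|k IH _ [u /IH[x [t [Sx tS tk ->]]]] [y Sy] <-].
    by exists z, [::]; split.
  exists x, (rcons t y); split; rewrite ?size_rcons ?tk ?foldl_rcons //.
  by move=> i; rewrite /= mem_rcons inE => /orP[/eqP->//|/tS].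
elim/last_ind: t tS => [_|t y IH tS] //=.
rewrite size_rcons foldl_rcons; exists (foldl amul x t).
  by apply: IH => i /= it; apply: tS; rewrite /= mem_rcons inE it orbT.
by exists y => //; apply: tS; rewrite /= mem_rcons inE eqxx.
Qed.

(** Local nilpotency of X modulo Z, tested on left-normed products of the
    generators alone; [nilpotency_has_law] below compares it with nilpotency of
    the generated subalgebras of the quotient. *)
Definition nil_mod (X Z : set G) : Prop :=
  forall S, finite_set S -> S `<=` X -> exists m, words S S m `<=` Z.

(** * Sums of locally nilpotent ideals *)

Section Leibniz.
Variable e : F.
Hypothesis mulA : forall x y z,
  amul (amul x y) z = amul x (amul y z) + e *: amul (amul x z) y.

Section WeightedProducts.
Variables A B : set G.

(** Left-normed products of blocks v = u y_1 ... y_r, u in A and y_i in B; a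
    block with r tail factors has weight r + 1 and weights add up.  In the use
    below, A lies in one locally nilpotent ideal and B in the other. *)
Inductive weighted : nat -> set G :=
| Weighted1 r u of words A B r u : weighted r.+1 u
| WeightedM L u r v of weighted L u & words A B r v :
    weighted (L + r.+1)%N (amul u v).

Lemma weighted_mulr_head L u y :
  weighted L u -> A y -> weighted L.+1 (amul u y).
Proof. by move=> Lu Ay; rewrite -addn1; apply: WeightedM. Qed.

(** Right multiplication by y acts on a product of blocks like a derivation
    (or, for e = 0, on the last block only), and lengthens one block by y. *)
Lemma weighted_mulr_tail L u y :
  weighted L u -> B y -> span (weighted L.+1) (amul u y).
Proof.
move=> Lu By; elim: Lu => {L u} [r u ru|L u r v Lu IH rv].
  by apply: sub_span; apply: Weighted1; exists u => //; exists y.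
have spansub := span_subspace (weighted (L + r.+1).+1).
rewrite mulA; apply: (subspaceD spansub).
  apply: sub_span; rewrite -addnS; apply: WeightedM => //.
  by exists v => //; exists y.
apply: (subspaceZ _ spansub); apply: (span_mulr spansub _ IH) => w Lw.
by apply: sub_span; rewrite -addSn; apply: WeightedM.
Qed.

Lemma span_weighted_mulr L u y : (A `|` B) y ->
  span (weighted L) u -> span (weighted L.+1) (amul u y).
Proof.
move=> ABy; apply: (span_mulr (span_subspace _)) => w Lw.
case: ABy => [Ay|By]; last exact: weighted_mulr_tail.
by apply: sub_span; apply: weighted_mulr_head.
Qed.

(** Blocks with more than m tail factors vanish modulo Z, so a product of large
    weight that does not vanish has many blocks, all taken from the set C, which
    is finite when A and B are. *)
Lemma weighted_bound (Z : ideal G) m L u :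
  words A B m.+1 `<=` Z -> weighted L u ->
  let C := \bigcup_(r in `I_m.+1) words A B r in
  ideal_set Z u \/ exists2 d, (L <= d.+1 * m.+1)%N & words C C d u.
Proof.
move=> mZ Lu C; elim: Lu => {L u} [r u ru|L u r v Lu IH rv].
  case: (ltnP r m.+1) => rm; last by left; apply: words_ideal_leq rm mZ _ ru.
  by right; exists 0%N; rewrite ?mul1n //; exists r.
case: (ltnP r m.+1) => rm; last first.
  by left; apply: ideal_mulr; apply: words_ideal_leq rm mZ _ rv.
case: IH => [Zu|[d Ld du]]; first by left; apply: ideal_mull.
right; exists d.+1; first by rewrite mulSn addnC leq_add.
by exists u => //; exists v => //; exists r.
Qed.

End WeightedProducts.

(** The generators are split into A in I and B in J.  In a left-normed product
    of these letters, a long prefix of letters of B vanishes; otherwise the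
    prefix together with the first letter of A lies in a finite set A' inside I,
    and the rest is expanded into products of blocks with heads in A'.  Long
    blocks vanish because they lie in J, and products of many short blocks vanish
    because those form a finite subset of I. *)
Theorem nil_mod_add (I J Z : ideal G) :
  nil_mod I Z -> nil_mod J Z -> nil_mod (ideal_add I J) Z.
Proof.
move=> nilI nilJ S finS SIJ.
have /choice[p pP] x : exists p : G * G,
    S x -> [/\ ideal_set I p.1, ideal_set J p.2 & p.1 + p.2 = x].
  case: (pselect (S x)) => [/SIJ[a Ia [b Jb <-]]|nSx]; last by exists (0, 0).
  by exists (a, b).
pose A := (fst \o p) @` S; pose B := (snd \o p) @` S.
have finA : finite_set A by apply: finite_image.
have finB : finite_set B by apply: finite_image.
have AI : A `<=` I by move=> _ [x Sx <-]; have [] := pP x Sx.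
have BJ : B `<=` J by move=> _ [x Sx <-]; have [] := pP x Sx.
have SAB : S `<=` span (A `|` B).
  move=> x Sx; have [_ _ <-] := pP x Sx.
  apply: (subspaceD (span_subspace _)); apply: sub_span.
    by left; exists x.
  by right; exists x.
have [m1 m1Z] := nilJ B finB BJ.
pose A' := A `|` \bigcup_(k in `I_m1) [set amul u y | u in words B B k & y in A].
have finA' : finite_set A'.
  rewrite finite_setU; split=> //; apply: bigcup_finite => [|k _].
    exact: finite_II.
  by apply: finite_image2 => //; apply: finite_words.
have A'I : A' `<=` I.
  move=> _ [/AI//|[k _ [u _ [y /AI Iy <-]]]]; exact: ideal_mulr.
(* Nilpotency in J is applied to A' * B, since A' itself need not lie in J. *)
pose B' := B `|` [set amul u y | u in A' & y in B].
have [|_ [/BJ//|[u _ [y /BJ Jy <-]]]|m2 m2Z] := nilJ B'.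
- by rewrite finite_setU; split=> //; apply: finite_image2.
- exact: ideal_mulr.
have m2AB : words A' B m2.+1 `<=` Z.
  rewrite words_shift; apply: subset_trans m2Z; apply: words_mono => x Bx.
    by right.
  by left.
pose C := \bigcup_(r in `I_m2.+1) words A' B r.
have [|x [r _]|m3 m3Z] := nilI C.
- apply: bigcup_finite => [|r _]; [exact: finite_II|exact: finite_words].
- exact: words_sub_ideal.
have weightedZ L : (m3 * m2.+1 < L)%N -> span (weighted A' B L) `<=` Z.
  move=> ltL; apply: span_min; first exact: ideal_subspace.
  move=> u /(weighted_bound m2AB)[//|[d Ld du]].
  apply: words_ideal_leq m3Z _ du.
  by move: (leq_trans ltL Ld); rewrite ltn_pmul2r.
exists (m1 + m3 * m2.+1)%N.
apply: subset_trans (words_span SAB) _.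
apply: span_min; first exact: ideal_subspace.
(* A head from A' has weight 1 but stands for at most m1 letters. *)
have key k u : words (A `|` B) (A `|` B) k u -> [\/ words B B k u, ideal_set Z u |
    exists2 L, (k < L + m1)%N & span (weighted A' B L) u].
  elim: k u => [u [Au|Bu]|k IH _ [u /IH{}IH [y ABy <-]]].
  - constructor 3; exists 1%N => //; apply: sub_span; apply: Weighted1.
    by left.
  - by constructor 1.
  case: IH => [Bu|Zu|[L kL Lu]].
  - case: ABy => [Ay|By]; last by constructor 1; exists u => //; exists y.
    case: (ltnP k m1) => km1.
      constructor 3; exists 1%N; first by rewrite add1n.
      apply: sub_span; apply: Weighted1; right; exists k => //.
      by exists u => //; exists y.
    by constructor 2; apply: ideal_mull; apply: words_ideal_leq km1 m1Z _ Bu.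
  - by constructor 2; apply: ideal_mull.
  - constructor 3; exists L.+1; first by rewrite addSn.
    apply: span_weighted_mulr Lu.
    by case: ABy => [Ay|By]; [left; left|right].
move=> u /key[Bu|//|[L kL]].
  exact: words_ideal_leq (leq_addr _ _) m1Z _ Bu.
by apply: weightedZ; rewrite -(ltn_add2r m1) addnC.
Qed.

(** The span of all left-normed products with at least j tail factors.  For
    j = 0 this is the subalgebra generated by S. *)
Definition long_span S j : set G :=
  span (\bigcup_(k in [set k | (j <= k)%N]) words S S k).

Lemma long_span_mulr S j u y : S y -> long_span S j u ->
  long_span S j.+1 (amul u y).
Proof.
move=> Sy; apply: (span_mulr (span_subspace _)) => w [k jk kw].
by apply: sub_span; exists k.+1 => //; exists w => //; exists y.
Qed.

(** In an associative or Lie algebra a product of left-normed products is a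
    combination of left-normed ones with the same letters; the filtration
    [long_span] is therefore multiplicative. *)
Lemma long_span_mul S i j u v :
  long_span S i u -> long_span S j v -> long_span S (i + j).+1 (amul u v).
Proof.
move=> iu; apply: (span_mull (span_subspace _)) => {}v [k /= jk kv].
suff: long_span S (i + k).+1 (amul u v).
  apply: span_mono => w [l /= il lw]; exists l => //=.
  by apply: leq_trans il; rewrite ltnS leq_add2l.
elim: k i u v iu kv {j jk} => [|k IH] i u v iu /=.
  by move=> Sv; rewrite addn0; apply: long_span_mulr.
move=> [w kw [y Sy <-]].
have -> : amul u (amul w y) = amul (amul u w) y - e *: amul (amul u y) w.
  by rewrite mulA addrK.
apply: (subspaceB (span_subspace _)).
  by rewrite addnS; apply: long_span_mulr => //; apply: IH.
apply: (subspaceZ _ (span_subspace _)).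
by rewrite addnS -addSn; apply: IH => //; apply: long_span_mulr.
Qed.

Lemma nilpotent_generated S m :
  words S S m `<=` [set 0] ->
  nilpotent_subalg (smallest (@is_subalgebra F G) S).
Proof.
move=> m0; exists m.
have subS : smallest (@is_subalgebra F G) S `<=` long_span S 0.
  apply: smallest_sub; last by move=> x Sx; apply: sub_span; exists 0%N.
  split; first exact: span_subspace.
  move=> x y Sx Sy; have := long_span_mul Sx Sy; apply: span_mono.
  by move=> w [k _ kw]; exists k.
have long_foldl x s j : long_span S j x -> [set` s] `<=` long_span S 0 ->
    long_span S (j + size s) (foldl amul x s).
  elim: s x j => [|y s IH] x j jx sS /=; first by rewrite addn0.
  rewrite addnS -addSn; apply: IH.
    rewrite -[j]addn0; apply: long_span_mul => //; apply: sS.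
    by rewrite /= inE eqxx.
  by move=> i /= si; apply: sS; rewrite /= inE si orbT.
have long0 : long_span S m `<=` [set 0].
  apply: span_min; first exact: subspace_set0.
  move=> w [k /= /subnK <-]; elim: (k - m)%N w => [|i IH] w; first exact: m0.
  by move=> [u /IH -> [y _ <-]] /=; rewrite (lin0 (amul_linearl y)).
move=> x s Sx sS ms; apply: long0; rewrite -ms -[size s]add0n.
by apply: long_foldl; [exact: subS|apply: subset_trans sS subS].
Qed.

End Leibniz.

(** Associativity is the case e = 0, and the Jacobi identity the case e = 1. *)
Lemma assoc_or_lie_mulA : is_associative G \/ is_lie G ->
  exists e : F, forall x y z,
    amul (amul x y) z = amul x (amul y z) + e *: amul (amul x z) y.
Proof.
move=> [assoc|[alt jac]].
  by exists 0 => x y z; rewrite scale0r addr0 assoc.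
have anti x y : amul x y = - amul y x.
  have := alt (x + y).
  rewrite (linD (amul_linearl _)) !(linD (amul_linearr _)) !alt add0r addr0.
  by move/eqP; rewrite addr_eq0 => /eqP.
exists 1 => x y z; rewrite scale1r; have := jac x y z.
have -> : amul y (amul z x) = amul (amul x z) y.
  by rewrite [amul z x]anti -scaleN1r (linZ (amul_linearr y)) scaleN1r -anti.
rewrite [amul z (amul x y)]anti.
by move/eqP; rewrite subr_eq0 => /eqP ->.
Qed.

End Subspaces.

(** * Multilinear identities *)

Section Identities.
Variables (F : fieldType) (G : naAlgType F).

Definition ml_value (w : mlpoly F) (H : naAlgType F)
    (v : 'I_(ml_arity w) -> H) : H :=
  \sum_(p <- ml_terms w) p.1 *: meval v p.2.

Lemma meval_morph (H : naAlgType F) (f : G -> H) X (v : X -> G) t :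
  {morph f : x y / amul x y} -> meval (f \o v) t = f (meval v t).
Proof. by move=> fM; elim: t => //= t1 -> t2 ->; rewrite fM. Qed.

Lemma ml_value_morph (H : naAlgType F) (f : G -> H) (w : mlpoly F) v :
  linear f -> {morph f : x y / amul x y} ->
  ml_value (f \o v) = f (@ml_value w G v).
Proof.
move=> f_lin fM; rewrite /ml_value.
elim: (ml_terms w) => [|p r IH]; first by rewrite !big_nil (lin0 f_lin).
by rewrite !big_cons IH f_lin meval_morph.
Qed.

Lemma meval_ideal (I : ideal G) X (v : X -> G) t :
  (forall i, ideal_set I (v i)) -> ideal_set I (meval v t).
Proof. by move=> Iv; elim: t => //= t1 It1 t2 _; apply: ideal_mull. Qed.

Lemma ml_value_ideal (I : ideal G) (w : mlpoly F) (v : _ -> G) :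
  (forall i, ideal_set I (v i)) -> ideal_set I (@ml_value w G v).
Proof.
move=> Iv; apply: (subspace_sum _ (ideal_subspace I)) => p.
by apply: (subspaceZ _ (ideal_subspace I)); apply: meval_ideal.
Qed.

Section Additivity.
Variables (X : eqType) (i0 : X) (v va vb : X -> G).
Hypotheses (v_i0 : v i0 = va i0 + vb i0).
Hypotheses (va_off : forall i, i != i0 -> va i = v i).
Hypotheses (vb_off : forall i, i != i0 -> vb i = v i).

Lemma meval_off (v' : X -> G) t : (forall i, i != i0 -> v' i = v i) ->
  i0 \notin vars t -> meval v' t = meval v t.
Proof.
move=> v'_off; elim: t => [i|t1 IH1 t2 IH2] /=.
  by rewrite inE eq_sym; apply: v'_off.
by rewrite mem_cat negb_or => /andP[/IH1 -> /IH2 ->].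
Qed.

Lemma meval_add t : uniq (vars t) -> i0 \in vars t ->
  meval v t = meval va t + meval vb t.
Proof.
elim: t => [i _|t1 IH1 t2 IH2] /=; first by rewrite inE => /eqP <-.
rewrite cat_uniq mem_cat => /and3P[u1 /hasPn dis u2] /orP[in1|in2].
  have out2 : i0 \notin vars t2 by apply/negP => /dis; rewrite in1.
  rewrite IH1 // (meval_off va_off out2) (meval_off vb_off out2).
  by rewrite (linD (amul_linearl _)).
have out1 := dis _ in2.
rewrite IH2 // (meval_off va_off out1) (meval_off vb_off out1).
by rewrite (linD (amul_linearr _)).
Qed.

End Additivity.

Lemma ml_value_add (w : mlpoly F) i0 (v va vb : 'I_(ml_arity w) -> G) :
  v i0 = va i0 + vb i0 -> (forall i, i != i0 -> va i = v i) ->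
  (forall i, i != i0 -> vb i = v i) ->
  ml_value v = ml_value va + ml_value vb.
Proof.
move=> v_i0 va_off vb_off; rewrite /ml_value.
elim: (ml_terms w) (ml_multilinear w) => [|p r IH] /=.
  by rewrite !big_nil addr0.
move=> /andP[pw /IH{}IH]; rewrite !big_cons IH addrACA -scalerDr.
rewrite (meval_add v_i0 va_off vb_off) //.
  by rewrite (perm_uniq pw) enum_uniq.
by rewrite (perm_mem pw) mem_enum.
Qed.

End Identities.

(** * Laws of a single factor *)

Section FactorLaws.
Variables (F : fieldType) (G : naAlgType F).

Lemma automorphism_linear (phi : G -> G) : is_automorphism phi -> linear phi.
Proof. by case. Qed.

Lemma preimage_mul (phi : G -> G) (phiP : is_automorphism phi)
    (I : ideal G) x y :
  (phi @^-1` I) x -> (phi @^-1` I) (amul x y) /\ (phi @^-1` I) (amul y x).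
Proof.
case: phiP => _ _ phiM; rewrite /preimage /= !phiM => Ix.
by split; [apply: ideal_mull|apply: ideal_mulr].
Qed.

Definition ideal_preim (phi : G -> G) (phiP : is_automorphism phi)
    (I : ideal G) : ideal G :=
  Ideal (subspace_preimage (automorphism_linear phiP) (ideal_subspace I))
    (@preimage_mul phi phiP I).

(** Additivity at t0 for tuples that agree elsewhere is equivalent, given
    antitonicity, to closure under [join_at t0] for arbitrary tuples. *)
Definition join_at (T : eqType) (t0 : T) (X Y : T -> ideal G) : T -> ideal G :=
  fun t => if t == t0 then ideal_add (X t) (Y t) else ideal_cap (X t) (Y t).

Record multiadditive (T : finType) (P : (T -> ideal G) -> Prop) : Prop := {
  multi_anti : forall X Y : T -> ideal G,
    (forall t, X t `<=` Y t) -> P Y -> P X;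
  multi_join : forall t0 X Y, P X -> P Y -> P (join_at t0 X Y);
  multi_preim : forall phi (phiP : is_automorphism phi) X,
    P X -> P (fun t => ideal_preim phiP (X t))
}.

(** A relation between tuples of ideals and ideals, to be read as: the tuple
    satisfies the law modulo Z.  Joining adds the moduli, so that laws can be
    composed. *)
Record factor_law (U : finType) (R : (U -> ideal G) -> ideal G -> Prop) :
    Prop := {
  law_anti : forall (X Y : U -> ideal G) Z,
    (forall u, X u `<=` Y u) -> R Y Z -> R X Z;
  law_join : forall u0 X Y Z Z',
    R X Z -> R Y Z' -> R (join_at u0 X Y) (ideal_add Z Z');
  law_cap : forall X Z Z', R X Z -> R X Z' -> R X (ideal_cap Z Z');
  law_preim : forall phi (phiP : is_automorphism phi) X Z,
    R X Z -> R (fun u => ideal_preim phiP (X u)) (ideal_preim phiP Z);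
  law_refl : forall X, R (fun=> X) X;
  law_ext : forall X (Z Z' : ideal G), Z = Z' :> set G -> R X Z -> R X Z'
}.

(** Only the diagonal of R is determined by the factor type. *)
Definition has_law (U : finType) (R : (U -> ideal G) -> ideal G -> Prop) c :=
  forall X Z : ideal G, has_factor_type (quot_pi Z @` X) c <-> R (fun=> X) Z.

Lemma quot_pi0P (Z : ideal G) x : quot_pi Z x = 0 <-> ideal_set Z x.
Proof. by rewrite -(lin0 (@quot_pi_linear F G Z)) quot_piP subr0. Qed.

Definition identity_law (w : mlpoly F) (X : 'I_(ml_arity w) -> ideal G)
    (Z : ideal G) : Prop :=
  forall v, (forall i, ideal_set (X i) (v i)) -> ideal_set Z (@ml_value F w G v).

Lemma identity_factor_law w : factor_law (@identity_law w).
Proof.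
split=> [X Y Z XY YZ v Xv|i0 X Y Z Z' XZ YZ v XYv|X Z Z' XZ XZ' v Xv|||].
- by apply: YZ => i; apply: XY.
- have := XYv i0; rewrite /join_at eqxx => -[a Xa [b Yb ab]].
  pose va i := if i == i0 then a else v i.
  pose vb i := if i == i0 then b else v i.
  have off i : i != i0 -> (ideal_cap (X i) (Y i) : set G) (v i).
    by move=> ne; have := XYv i; rewrite /join_at (negPf ne).
  exists (ml_value va).
    apply: XZ => i; rewrite /va; case: (eqVneq i i0) => [->//|].
    by move=> /off[].
  exists (ml_value vb).
    apply: YZ => i; rewrite /vb; case: (eqVneq i i0) => [->//|].
    by move=> /off[].
  symmetry; apply: (@ml_value_add F G w i0); rewrite /va /vb ?eqxx //.
    by move=> i /negPf->.
  by move=> i /negPf->.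
- by split; [apply: XZ|apply: XZ'].
- move=> phi [phi_lin phi_bij phiM] X Z XZ v Xv; rewrite /ideal_preim /= /preimage /=.
  by rewrite -ml_value_morph //; apply: XZ.
- by move=> X v Xv; apply: ml_value_ideal.
- by move=> X Z Z' ZZ' XZ v /XZ; rewrite ZZ'.
Qed.

Lemma identity_has_law w : has_law (@identity_law w) (Identity w).
Proof.
move=> X Z; have pi_lin := @quot_pi_linear F G Z.
have pi_mul : {morph quot_pi Z : x y / amul x y} := @quot_piM F G Z.
split=> [idw v Xv|idw v /= Xv].
  apply/quot_pi0P; rewrite -ml_value_morph //; apply: idw => i.
  by exists (v i).
have /choice[g gP] i : exists x, ideal_set X x /\ quot_pi Z x = v i.
  by have [x Xx <-] := Xv i; exists x.
have -> : v = quot_pi Z \o g by apply/funext => i /=; have [_ ->] := gP i.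
have /quot_pi0P : ideal_set Z (ml_value g) by apply: idw => i; have [] := gP i.
by rewrite -ml_value_morph.
Qed.

Lemma words_image (H : naAlgType F) (f : G -> H) (S : set G) k :
  {morph f : x y / amul x y} -> words (f @` S) (f @` S) k = f @` words S S k.
Proof.
move=> fM; elim: k => //= k ->; apply/seteqP; split=> w.
  move=> [_ [u ku <-] [_ [y Sy <-] <-]]; exists (amul u y); last exact: fM.
  by exists u => //; exists y.
move=> [_ [u ku [y Sy <-]] <-]; exists (f u); first by exists u.
by exists (f y); [exists y|rewrite fM].
Qed.

Definition nilpotency_law (X : unit -> ideal G) (Z : ideal G) : Prop :=
  nil_mod (X tt) Z.

Hypothesis G_assoc_or_lie : is_associative G \/ is_lie G.

(** Additivity is the Hirsch-Plotkin theorem, applied modulo Z + Z'. *)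
Lemma nilpotency_factor_law : factor_law nilpotency_law.
Proof.
have [e mulA] := assoc_or_lie_mulA G_assoc_or_lie.
split=> [X Y Z XY YZ S finS SX|[] X Y Z Z' XZ YZ|X Z Z' XZ XZ' S finS SX|||].
- by apply: YZ => //; apply: subset_trans SX (XY tt).
- rewrite /nilpotency_law /join_at eqxx; apply: (nil_mod_add mulA).
    move=> S finS /(XZ S finS)[m mZ]; exists m.
    by apply: subset_trans mZ _; apply: ideal_add_subl.
  move=> S finS /(YZ S finS)[m mZ]; exists m.
  by apply: subset_trans mZ _; apply: ideal_add_subr.
- have [m mZ] := XZ S finS SX; have [m' mZ'] := XZ' S finS SX.
  exists (maxn m m') => z zm; split.
    exact: words_ideal_leq (leq_maxl m m') mZ _ zm.
  exact: words_ideal_leq (leq_maxr m m') mZ' _ zm.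
- move=> phi [phi_lin phi_bij phiM] X Z XZ S finS SX.
  have [|_ [x /SX Xx <-]//|m mZ] := XZ (phi @` S).
    exact: finite_image.
  exists m => z zm; apply: mZ; rewrite words_image //; by exists z.
- by move=> X S finS SX; exists 0%N.
- by move=> X Z Z' ZZ'; rewrite /nilpotency_law ZZ'.
Qed.

(** That vanishing left-normed products of generators force nilpotency of the
    generated subalgebra is [nilpotent_generated], applied in the quotient,
    where the same product identity holds. *)
Lemma nilpotency_has_law : has_law nilpotency_law LocallyNilpotent.
Proof.
move=> X Z; pose f := quot_pi Z; have f_lin : linear f := @quot_pi_linear F G Z.
have fM : {morph f : x y / amul x y} := @quot_piM F G Z.
have [e mulA] := assoc_or_lie_mulA G_assoc_or_lie.
rewrite /nilpotency_law /=; split=> [LN S finS SX|nilX s sX].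
  have /finite_seqP[s sE] : finite_set (f @` S) by apply: finite_image.
  have [|m mP] := LN s; first by rewrite -sE => _ [x /SX Xx <-]; exists x.
  exists m => z zm; apply/quot_pi0P; rewrite -/(f z).
  have : words (f @` S) (f @` S) m (f z) by rewrite words_image //; exists z.
  rewrite sE => /words_foldl[x [t [sx ts tm ->]]].
  apply: mP => //; first exact: sub_smallest sx.
  by apply: subset_trans ts _; apply: sub_smallest.
have /choice[g gP] q : exists x, q \in s -> ideal_set X x /\ f x = q.
  case: (pselect (q \in s)) => [/[dup] qs /sX[x Xx <-]|nqs]; last by exists 0.
  by exists x.
have [||m mZ] := nilX (g @` [set` s]).
- by apply: finite_image; apply: finite_seq.
- by move=> _ [q /gP[Xq _] <-].
have sE : [set` s] = f @` (g @` [set` s]).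
  apply/seteqP; split=> [q qs|_ [_ [q qs <-] <-]].
    by have [_ gq] := gP q qs; exists (g q) => //; exists q.
  by have [_ ->] := gP q qs.
apply: (@nilpotent_generated F _ e _ _ m).
  move=> p q r; rewrite -[p]quot_reprK -[q]quot_reprK -[r]quot_reprK.
  move: (repr p) (repr q) (repr r) => x y z; rewrite -/(f x) -/(f y) -/(f z).
  by have fmul := esym (fM _ _); rewrite !fmul mulA linD // linZ.
rewrite sE words_image // => _ [z /mZ Zz <-].
by apply/quot_pi0P.
Qed.

Lemma exists_factor_law c :
  exists (U : finType) (R : (U -> ideal G) -> ideal G -> Prop),
    factor_law R /\ has_law R c.
Proof.
case: c => [w|].
  by exists _, (@identity_law w); split;
    [apply: identity_factor_law|apply: identity_has_law].
by exists unit, nilpotency_law; split;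
  [apply: nilpotency_factor_law|apply: nilpotency_has_law].
Qed.

(** * Composition of laws *)

Section Composition.
Variables (T U : finType) (P : (T -> ideal G) -> Prop)
  (R : (U -> ideal G) -> ideal G -> Prop).
Hypotheses (multiP : multiadditive P) (lawR : factor_law R).

Definition compose_law (X : T * U -> ideal G) : Prop :=
  exists Z, P Z /\ forall t, R (fun u => X (t, u)) (Z t).

(** At (t0, u0) the moduli Z and Z' are joined at t0: the row t0 satisfies the
    law modulo the sum, and the other rows modulo the intersection. *)
Lemma compose_multiadditive : multiadditive compose_law.
Proof.
split=> [X Y XY [Z [PZ YZ]]|[t0 u0] X Y [Z [PZ XZ]] [Z' [PZ' YZ']]|].
- by exists Z; split=> // t; apply: (law_anti lawR) (YZ t) => u; apply: XY.
- exists (join_at t0 Z Z'); split; first exact: multi_join.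
  move=> t; rewrite {2}/join_at; case: (eqVneq t t0) => [->|ne].
    apply: (law_anti lawR) (law_join lawR u0 (XZ t0) (YZ' t0)) => u.
    by rewrite /join_at xpair_eqE eqxx.
  by apply: (law_cap lawR);
    [apply: (law_anti lawR) (XZ t)|apply: (law_anti lawR) (YZ' t)] => u x;
    rewrite /join_at xpair_eqE (negPf ne) => -[].
- move=> phi phiP X [Z [PZ XZ]]; exists (fun t => ideal_preim phiP (Z t)).
  split; first exact: (multi_preim multiP).
  by move=> t; apply: (law_preim lawR phiP (XZ t)).
Qed.

(** The witnesses Z_t of a constant tuple may be distinct; as there are finitely
    many of them, their intersection with X serves for all t. *)
Lemma compose_diagonal (X : ideal G) :
  compose_law (fun=> X) <->
  exists Y : ideal G, [/\ Y `<=` X, P (fun=> Y) & R (fun=> X) Y].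
Proof.
split=> [[Z [PZ XZ]]|[Y [YX PY XY]]]; last by exists (fun=> Y).
have [Y [YX XY YZ]] : exists Y : ideal G,
    [/\ Y `<=` X, R (fun=> X) Y & forall t, t \in enum T -> Y `<=` Z t].
  elim: (enum T) => [|t0 s [Y [YX XY YZ]]].
    by exists X; split=> //; apply: (law_refl lawR).
  exists (ideal_cap (Z t0) Y); split; first by move=> x [_ /YX].
    exact: (law_cap lawR).
  by move=> t; rewrite inE => /predU1P[-> x []//|/YZ tY x [_ /tY]].
exists Y; split=> //; apply: (multi_anti multiP) PZ => t.
by apply: YZ; rewrite mem_enum.
Qed.

End Composition.

(** Series of length 0 on the diagonal, see [series_multiadditive]. *)
Lemma zero_multiadditive :
  multiadditive (fun X : unit -> ideal G => X tt `<=` [set 0]).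
Proof.
split=> [X Y XY Y0|[] X Y X0 Y0|phi [phi_lin phi_bij phiM] X X0].
- exact: subset_trans (XY tt) Y0.
- by rewrite /join_at eqxx => _ [x /X0 -> [y /Y0 -> <-]]; rewrite /= addr0.
- move=> x /X0 /= phi_x; apply: (bij_inj phi_bij).
  by rewrite phi_x (lin0 phi_lin).
Qed.

End FactorLaws.

(** * Series as diagonals of multiadditive predicates *)

Section Series.
Variables (F : fieldType) (G : naAlgType F).
Hypothesis G_assoc_or_lie : is_associative G \/ is_lie G.

Lemma has_seriesS n c (X : ideal G) :
  has_series n.+1 c X <-> exists Y : ideal G,
    [/\ Y `<=` X, has_series n c Y & has_factor_type (quot_pi Y @` X) (c n)].
Proof.
split=> [[A [A0 AX Asub Afac]]|[Y [YX [A [A0 AY Asub Afac]] Xfac]]].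
  exists (A n); split; first by rewrite -AX; apply: Asub.
    exists A; split=> // i lt_in; [apply: Asub|apply: Afac]; exact: ltnW.
  by rewrite -AX; apply: Afac.
have [U [R [lawR hasR]]] := exists_factor_law G_assoc_or_lie (c n).
exists (fun i => if (i <= n)%N then A i else X).
have split_lt i : (i < n.+1)%N -> i = n \/ (i < n)%N.
  by rewrite ltnS leq_eqVlt => /predU1P.
split=> [//||i /split_lt[->|lt_in]|i /split_lt[->|lt_in]]; rewrite ?leqnn ?ltnn //.
- by rewrite AY.
- by rewrite (ltnW lt_in) lt_in; apply: Asub.
- apply/hasR; apply: (law_ext lawR (esym AY)); exact/hasR.
- by rewrite (ltnW lt_in) lt_in; apply: Afac.
Qed.

Lemma series_multiadditive n c :
  exists (T : finType) (P : (T -> ideal G) -> Prop), multiadditive P /\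
    forall X, P (fun=> X) <-> has_series n c X.
Proof.
elim: n => [|n [T [P [multiP PE]]]].
  exists unit, (fun X => X tt `<=` [set 0]).
  split=> [|X]; first exact: zero_multiadditive.
  split=> [X0|[A [A0 AX _ _]]]; last by rewrite -AX A0.
  exists (fun=> X); split=> //; apply/seteqP; split=> // _ ->.
  by case: (ideal_subspace X).
have [U [R [lawR hasR]]] := exists_factor_law G_assoc_or_lie (c n).
exists (T * U)%type, (compose_law P R).
split=> [|X]; first exact: compose_multiadditive.
rewrite (compose_diagonal multiP lawR) has_seriesS.
by split=> -[Y [YX PY XY]]; exists Y; split=> //;
  [apply/PE|apply/hasR|apply/PE|apply/hasR].
Qed.

End Series.

(** * Finite codimension *)

Section FiniteCodimension.
Variables (F : fieldType) (G : naAlgType F).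

(** S contains the kernel of a linear map to a finite-dimensional space; this
    form is stable under enlarging, intersections and preimages without any
    computation of dimensions. *)
Definition finite_codim (S : set G) : Prop :=
  exists m (f : G -> 'rV[F]_m), linear f /\ forall x, f x = 0 -> S x.

Lemma finite_codim_sub (S S' : set G) :
  S `<=` S' -> finite_codim S -> finite_codim S'.
Proof. by move=> SS' [m [f [f_lin fS]]]; exists m, f; split=> // x /fS/SS'. Qed.

Lemma finite_codim_cap (S S' : set G) :
  finite_codim S -> finite_codim S' -> finite_codim (S `&` S').
Proof.
move=> [m [f [f_lin fS]]] [m' [f' [f'_lin fS']]].
exists (m + m')%N, (fun x => row_mx (f x) (f' x)); split=> [a x y|x].
  by rewrite f_lin f'_lin scale_row_mx add_row_mx.
by rewrite -row_mx0 => /eq_row_mx[/fS ? /fS' ?].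
Qed.

Lemma finite_codim_preimage (S : set G) (phi : G -> G) :
  linear phi -> finite_codim S -> finite_codim (phi @^-1` S).
Proof.
move=> phi_lin [m [f [f_lin fS]]]; exists m, (f \o phi).
by split=> [a x y|x /fS//]; rewrite /= phi_lin f_lin.
Qed.

Lemma finite_dimensional_codim (I : ideal G) :
  finite_dimensional (quot_alg I) -> finite_codim I.
Proof.
move=> [m [[v v_lin v_bij]]]; exists m, (v \o quot_pi I).
split=> [a x y|x]; first by rewrite /= quot_pi_linear v_lin.
rewrite -[RHS](lin0 v_lin) => /(bij_inj v_bij) x0.
exact/quot_pi0P.
Qed.

Lemma finite_span (m : nat) (S : set 'rV[F]_m) :
  exists s : seq 'rV[F]_m, [set` s] `<=` S /\ S `<=` [set` <<s>>%VS].
Proof.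
pose Q d := `[< exists2 s, [set` s] `<=` S & \dim <<s>> = d >].
have Q0 : exists d, Q d.
  by exists 0%N; apply/asboolP; exists [::]; rewrite ?span_nil ?dimv0.
have Qm d : Q d -> (d <= m)%N.
  move=> /asboolP[s _ <-]; have := dimvS (subvf <<s>>).
  by rewrite dimvf /dim /= mul1n.
have [d /asboolP[s sS sd] dmax] := ex_maxnP Q0 Qm.
exists s; split=> // v Sv.
have vS : [set` v :: s] `<=` S by move=> u /=; rewrite inE => /predU1P[->|/sS].
have le_d : (\dim <<v :: s>> <= d)%N by apply: dmax; apply/asboolP; exists (v :: s).
have sub_s : (<<s>> <= <<v :: s>>)%VS by rewrite span_cons addvSr.
have /eqP E : <<s>>%VS == <<v :: s>>%VS by rewrite eqEdim sub_s sd.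
by rewrite /= E memv_span // mem_head.
Qed.

Lemma lift_span (m : nat) (f : G -> 'rV[F]_m) (S : set G) (s : seq 'rV[F]_m) :
  linear f -> is_subspace S -> [set` s] `<=` f @` S ->
  [set` <<s>>%VS] `<=` f @` S.
Proof.
move=> f_lin [S0 Slin]; elim: s => [_ v /=|u s IH sS v /=].
  by rewrite span_nil memv0 => /eqP->; exists 0 => //; apply: lin0.
rewrite span_cons => /memv_addP[_ /vlineP[k ->] [w ws ->]].
have [|x Sx <-] := sS u; first by rewrite /= mem_head.
have [|y Sy <-] := IH _ w ws.
  by move=> z zs; apply: sS; rewrite /= inE zs orbT.
by exists (k *: x + y); [apply: Slin|apply: f_lin].
Qed.

(** f is followed by the projection along the span of f(I), so that the kernel
    becomes exactly I. *)
Lemma finite_codim_kernel (I : ideal G) : finite_codim I ->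
  exists m (h : G -> 'rV[F]_m), linear h /\ forall x, h x = 0 <-> ideal_set I x.
Proof.
move=> [m [f [f_lin fI]]].
have [s [sI Is]] := finite_span (f @` I).
have lift := lift_span f_lin (ideal_subspace I) sI.
exists m, (fun x => f x - projv <<s>> (f x)); split=> [a x y|x].
  by rewrite f_lin linearP scalerBr addrACA opprD.
split=> [/eqP|Ix]; last first.
  rewrite projv_id ?subrr //; apply: Is; by exists x.
rewrite subr_eq0 => /eqP fx.
have [|y Iy fy] := lift (f x); first by rewrite /= fx memv_proj.
rewrite -[x](subrK y); apply: (subspaceD (ideal_subspace I)) => //.
by apply: fI; rewrite (linB f_lin) fy subrr.
Qed.

Lemma finite_codim_dimensional (I : ideal G) :
  finite_codim I -> finite_dimensional (quot_alg I).
Proof.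
move=> /finite_codim_kernel[m [h [h_lin hI]]].
have [s [sh hs]] := finite_span (range h).
have lift := lift_span h_lin (@setT_subspace F G) sh.
have hE x : h (repr (quot_pi I x)) = h x.
  apply/eqP; rewrite -subr_eq0 -(linB h_lin); apply/eqP/hI/quot_piP.
  exact: quot_reprK.
have hU x : h x \in <<s>>%VS by apply: hs; exists x.
have [w w_lin [w' w'K wK]] := subvs_vect_iso <<s>>.
pose v (q : quot_alg I) := w (vsproj <<s>> (h (repr q))).
have v_lin : linear v.
  move=> a q r; rewrite -[q]quot_reprK -[r]quot_reprK -quot_pi_linear.
  by rewrite /v !hE h_lin linearP w_lin.
exists (\dim <<s>>); constructor; exists v => //.
have /choice[g gP] u : exists x, h x = vsval (w' u).
  by have [x _ hx] := lift _ (subvsP (w' u)); exists x.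
exists (quot_pi I \o g) => [q|u]; last by rewrite /v /= hE gP vsvalK wK.
rewrite -[RHS]quot_reprK; apply/quot_piP/hI; rewrite (linB h_lin) gP.
by rewrite w'K vsprojK // subrr.
Qed.

(** * Orbits of an ideal under automorphisms *)

(** The images of N are written as preimages: they run over the same family,
    the automorphisms being a group. *)
Definition orbit_sum (N : ideal G)
    (ps : seq {phi : G -> G | is_automorphism phi}) : ideal G :=
  foldr (fun p K => ideal_add (ideal_preim (svalP p) N) K) N ps.

Definition orbit_cap (N : ideal G)
    (ps : seq {phi : G -> G | is_automorphism phi}) : ideal G :=
  foldr (fun p K => ideal_cap (ideal_preim (svalP p) N) K) N ps.

Lemma finite_codim_orbit_cap (N : ideal G) ps :
  finite_codim N -> finite_codim (orbit_cap N ps).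
Proof.
move=> finN; elim: ps => //= p ps IH; apply: finite_codim_cap => //.
by apply: finite_codim_preimage => //; apply: automorphism_linear (svalP p).
Qed.

Lemma sub_orbit_sum (N : ideal G) ps : N `<=` orbit_sum N ps.
Proof.
elim: ps => [|p ps IH x /IH Kx] //.
exact: (@ideal_add_subr _ _ _ (orbit_sum N ps)).
Qed.

Lemma orbit_sum_min (N K : ideal G) ps : N `<=` K ->
  (forall phi (phiP : is_automorphism phi), ideal_preim phiP N `<=` K) ->
  orbit_sum N ps `<=` K.
Proof.
move=> NK pK; elim: ps => [|p ps IH] //.
exact: ideal_add_min (pK _ (svalP p)) IH.
Qed.

Lemma orbit_cap_sub (N : ideal G) ps : orbit_cap N ps `<=` N.
Proof. by elim: ps => //= p ps IH x [_ /IH]. Qed.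

(** Modulo N everything takes place in a finite-dimensional space, so the sum
    of all images of N is a finite sum. *)
Lemma exists_orbit_sum (N : ideal G) : finite_codim N ->
  exists ps, forall phi (phiP : is_automorphism phi),
    ideal_preim phiP N `<=` orbit_sum N ps.
Proof.
move=> [m [f [f_lin fN]]].
pose S := \bigcup_(p in [set: {phi : G -> G | is_automorphism phi}])
  ideal_preim (svalP p) N.
have [s [sS Ss]] := finite_span (f @` S).
have [ps psP] : exists ps, [set` s] `<=` f @` orbit_sum N ps.
  elim: s sS {Ss} => [|u s IH] sS; first by exists [::].
  have [|ps psP] := IH; first by move=> z zs; apply: sS; rewrite /= inE zs orbT.
  have [|x [p _ Nx] xu] := sS u; first by rewrite /= mem_head.
  exists (p :: ps) => v; rewrite /= inE => /predU1P[->|/psP[y Ky <-]].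
    by exists x => //;
      exact: (@ideal_add_subl _ _ (ideal_preim (svalP p) N) _ x Nx).
  by exists y => //;
    exact: (@ideal_add_subr _ _ (ideal_preim (svalP p) N) (orbit_sum N ps) y
      Ky).
exists ps => phi phiP x Nx.
have lift := lift_span f_lin (ideal_subspace (orbit_sum N ps)) psP.
have [|y Ky fy] := lift (f x).
  by apply: Ss; exists x => //; exists (exist _ phi phiP).
rewrite -[x](subrK y); apply: (subspaceD (ideal_subspace _)) => //.
by apply: sub_orbit_sum; apply: fN; rewrite (linB f_lin) fy subrr.
Qed.

(** Inclusion in the preimage suffices: applied to the inverse automorphism it
    gives equality, see [invariant_image]. *)
Definition invariant (H : ideal G) : Prop :=
  forall phi (phiP : is_automorphism phi), H `<=` ideal_preim phiP H.

Lemma automorphism_inverse (phi psi : G -> G) :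
  is_automorphism phi -> cancel phi psi -> cancel psi phi -> is_automorphism psi.
Proof.
move=> [phi_lin phi_bij phiM] phiK psiK; split; last first.
- by move=> x y; apply: (bij_inj phi_bij); rewrite phiM !psiK.
- by exists phi.
- by move=> a x y; apply: (bij_inj phi_bij); rewrite phi_lin !psiK.
Qed.

Lemma automorphism_comp (phi psi : G -> G) :
  is_automorphism phi -> is_automorphism psi -> is_automorphism (phi \o psi).
Proof.
move=> [phi_lin phi_bij phiM] [psi_lin psi_bij psiM]; split.
- by move=> a x y; rewrite /= psi_lin phi_lin.
- exact: bij_comp.
- by move=> x y; rewrite /= psiM phiM.
Qed.

Lemma invariant_image (H : ideal G) (phi : G -> G) :
  invariant H -> is_automorphism phi -> phi @` H = H.
Proof.
move=> invH phiP; have [_ [psi phiK psiK] _] := phiP.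
have psiP := automorphism_inverse phiP phiK psiK.
apply/seteqP; split=> [_ [x Hx <-]|x Hx]; first exact: invH.
by exists (psi x); [apply: (invH _ psiP)|].
Qed.

(** A sum that contains all the images is their sum, hence invariant. *)
Lemma orbit_sum_invariant (N : ideal G) ps :
  (forall phi (phiP : is_automorphism phi),
     ideal_preim phiP N `<=` orbit_sum N ps) ->
  invariant (orbit_sum N ps).
Proof.
move=> psN phi phiP; have [phi_lin [psi phiK psiK] _] := phiP.
have psiP := automorphism_inverse phiP phiK psiK.
apply: orbit_sum_min => [x Nx|chi chiP x Nx].
  by apply: (psN _ psiP); rewrite /= /preimage /= phiK.
apply: (psN _ (automorphism_comp chiP psiP)).
by rewrite /= /preimage /= phiK.
Qed.

(** * Symmetrization *)

Section Symmetrization.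
Variables (T : finType) (P : (T -> ideal G) -> Prop).
Hypothesis multiP : multiadditive P.

Definition with_slot (t0 : T) (I : ideal G) (Y : T -> ideal G) : T -> ideal G :=
  fun t => if t == t0 then I else Y t.

(** Additivity in the slot t0, applied to the summands of an orbit sum.  The
    ideal C keeps track of the automorphisms that occur: a common lower bound of
    the images need only lie below those. *)
Lemma multi_orbit_sum (N C : ideal G) ps t0 Y :
  P (with_slot t0 N Y) ->
  (forall p : {phi | is_automorphism phi}, C `<=` ideal_preim (svalP p) N ->
    P (with_slot t0 (ideal_preim (svalP p) N) Y)) ->
  C `<=` orbit_cap N ps -> P (with_slot t0 (orbit_sum N ps) Y).
Proof.
move=> PN Pp; elim: ps => //= p ps IH Cps.
have {}IH := IH (fun x Cx => (Cps x Cx).2).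
have {}Pp := Pp p (fun x Cx => (Cps x Cx).1).
apply: (multi_anti multiP) (multi_join multiP t0 Pp IH) => t.
by rewrite /with_slot /join_at; case: ifP => _ // x Yx; split.
Qed.

(** Downward induction on the number of slots that have to be filled by the
    small ideal N' rather than by the invariant ideal H.  Here #|T| - j is that
    number; it is 0 at j = #|T|, where N' disappears. *)
Theorem symmetrization (N : ideal G) : finite_codim N -> P (fun=> N) ->
  exists H : ideal G, [/\ finite_codim H, invariant H & P (fun=> H)].
Proof.
move=> finN PN.
suff [N' [H [finN' [N'H invH PH]]]] : exists N' H : ideal G, finite_codim N' /\
    [/\ N' `<=` H, invariant H &
      forall D : {set T}, (0 <= #|D|)%N -> P (fun t => if t \in D then N' else H)].
  exists H; split=> //; first exact: finite_codim_sub finN'.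
  apply: (multi_anti multiP) (PH finset.set0 isT) => t.
  by rewrite finset.in_set0.
suff step j : (j <= #|T|)%N -> exists N' H : ideal G, finite_codim N' /\
    [/\ N' `<=` H, invariant H &
      forall D : {set T}, (#|T| - j <= #|D|)%N ->
        P (fun t => if t \in D then N' else H)].
  have [N' [H [finN' [N'H invH PH]]]] := step _ (leqnn _).
  by exists N', H; split=> //; split=> // D _; apply: PH; rewrite subnn.
elim: j => [_|j IH lt_jT].
  exists N, (ideal_full G); split=> //; split=> // D; rewrite subn0 => leT.
  apply: (multi_anti multiP) PN => t.
  have /eqP -> : D == [set: T]%SET by rewrite eqEcard finset.subsetT cardsT.
  by rewrite finset.in_setT.
have [N1 [H1 [finN1 [N1H1 invH1 PH1]]]] := IH (ltnW lt_jT).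
have [ps psP] := exists_orbit_sum finN1.
have invK := orbit_sum_invariant psP.
have KH1 : orbit_sum N1 ps `<=` H1.
  apply: orbit_sum_min => // phi phiP x /N1H1 Hx.
  have [_ [psi phiK psiK] _] := phiP.
  by rewrite -[x]phiK; apply: (invH1 _ (automorphism_inverse phiP phiK psiK)).
have N2N1 := @orbit_cap_sub N1 ps.
exists (orbit_cap N1 ps), (orbit_sum N1 ps).
split; first exact: finite_codim_orbit_cap.
split=> // [|D leD]; first by apply: subset_trans N2N1 _; apply: sub_orbit_sum.
case: (leqP (#|T| - j)%N #|D|) => [leD'|ltD].
  apply: (multi_anti multiP) (PH1 D leD') => t.
  by case: ifP => _.
have [t0 t0D] : exists t0, t0 \notin D.
  apply/existsP; rewrite -negb_forall; apply/negP => /forallP allD.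
  move: ltD; rewrite ltnNge (leq_trans (leq_subr _ _)) //.
  by apply/subset_leq_card/fintype.subsetP => t _.
(* The tuple with N1 on D and at t0, and H1 elsewhere.  Its images under the
   automorphisms of the orbit sum dominate the summands of the goal. *)
have PD1 : P (fun t => if t \in (t0 |: D)%SET then N1 else H1).
  apply: PH1; rewrite finset.cardsU1 t0D add1n.
  by move: leD; rewrite subnS; case: (_ - _)%N.
set Y := fun t => if t \in D then _ else _.
have -> : Y = with_slot t0 (orbit_sum N1 ps) Y.
  apply/funext => t; rewrite /with_slot; case: eqP => // ->.
  by rewrite /Y (negPf t0D).
apply: (@multi_orbit_sum N1 (orbit_cap N1 ps)) => [|p N2p|//].
  apply: (multi_anti multiP) PD1 => t.
  rewrite /with_slot /Y finset.in_setU1; case: eqP => [_|_]; first by move=> x.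
  by rewrite /=; case: ifP => _.
apply: (multi_anti multiP) (multi_preim multiP (svalP p) PD1) => t.
rewrite /with_slot /Y finset.in_setU1; case: eqP => [_|_]; first by move=> x.
rewrite [_ || _]/=; case: ifP => _ //.
by apply: subset_trans KH1 _; apply: invH1.
Qed.

End Symmetrization.
End FiniteCodimension.

Theorem mainTheorem4 (F : fieldType) (G : naAlgType F)
    (G_assoc_or_lie : is_associative G \/ is_lie G)
    (N : ideal G) (finN : finite_dimensional (quot_alg N))
    (n : nat) (c : nat -> factor_type F) (serN : has_series n c N) :
  exists M : ideal G,
    [/\ finite_dimensional (quot_alg M),
        forall phi : G -> G, is_automorphism phi -> phi @` M = M :> set G &
        has_series n c M].
Proof.
have [T [P [multiP PE]]] := series_multiadditive G_assoc_or_lie n c.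
have [|M [finM invM PM]] :=
    symmetrization multiP (finite_dimensional_codim finN).
  exact/PE.
exists M; split; first exact: finite_codim_dimensional.
  by move=> phi; apply: invariant_image.
exact/PE.
Qed.
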